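(* Let $P_d$ be a polynomial of degree $d$, and let $a,b,c$ be real constants with $a,b>-1$ and $c>0$. For a complex number $s$ with $\mathrm{Re}(s)>\frac{d+1}{2}$ set $$z(s,a,b,c)=\sum_{n=1}^\infty \frac{P_d(cn)}{(cn+a)^s(cn+b)^s},$$ and, as a function of the variable $z$, set $$\phi(z,s,a,b,c)=\frac{P_d(cz)}{(cz+a)^s(cz+b)^s}.$$ Then for $\mathrm{Re}(s)>\frac{d+1}{2}$, $$z(s,a,b,c)=\frac12\,\phi(1,s,a,b,c)+\int_1^\infty \phi(z,s,a,b,c)\,dz+I(s),$$ where $I(s)$ is an integral (that is, entire) function of $s$.
   Context: The symbol $z(s,a,b,c)$ denotes the Dirichlet-type series, while $z$ alone, in $\phi$ and in the integral, denotes a variable.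
   Formalization: The formal statement also assumes c+a>0 and c+b>0; for c<1 these do not follow from a,b>-1, and without them cz+a or cz+b vanishes at some z≥1, so the integral of φ diverges for Re(s) large (e.g. c=1/2, a=-3/4, b=0, P=1). *)

(* Defs.v *)
(* Stdlib reals with Coquelicot; [C] is Coquelicot's type of complex numbers. *)
From Stdlib Require Import Reals.
From Coquelicot Require Export Coquelicot.
Open Scope R_scope.

Definition polynomial_of_degree (d : nat) (P : C -> C) : Prop :=
  exists p : nat -> C,
    p d <> RtoC 0 /\
    forall x : C, P x = sum_n (fun k => (p k * x ^ k)%C) d.

Definition Cexp (w : C) : C :=
  (exp (Re w) * cos (Im w), exp (Re w) * sin (Im w)).

(* The principal power x^s of a positive real x; [ln x] is a junk value for
   x <= 0, so this is meaningful only for x > 0. *)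
Definition Rcpow (x : R) (s : C) : C := Cexp (s * RtoC (ln x))%C.

Definition phi (P : C -> C) (z : R) (s : C) (a b c : R) : C :=
  (P (RtoC (c * z)) / (Rcpow (c * z + a) s * Rcpow (c * z + b) s))%C.

(* Coquelicot's series start at index 0; the sum is over n >= 1. *)
Definition dirichlet_terms (P : C -> C) (s : C) (a b c : R) (n : nat) : C :=
  phi P (INR (S n)) s a b c.

(* [iota] selects the sum, which is unique when it exists; the value is
   arbitrary for a divergent series. *)
Definition dirichlet_z (P : C -> C) (s : C) (a b c : R) : C :=
  @iota C_R_CompleteNormedModule
    (fun l => @is_series R_AbsRing C_R_NormedModule
                (dirichlet_terms P s a b c) l).

(* Complex differentiability: the scalars are [C_AbsRing], not the reals. *)
Definition entire (f : C -> C) : Prop :=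
  forall s : C, @ex_derive C_AbsRing C_NormedModule f s.

(* Main.v *)
(* Euler-Maclaurin summation. Let beta_0(x) = x - 1/2 and let beta_(k+1) be the
   primitive of beta_k with mean zero on [0,1] (Bernoulli polynomials up to a
   factor).  Integrating by parts on each [n, n+1] shows that the sum minus the
   integral minus phi(1)/2 is sum_n int_0^1 beta_0(x) phi'(n+x) dx, and further
   integrations by parts turn it into terms beta_k(0) phi^(k)(1,s), which are
   entire in s, plus a series in which phi^(k+1) replaces phi'.  Since
   phi^(k)(z,s) = O(z^(d - k - 2 Re s)), that series converges and is holomorphic
   on half-planes that exhaust C as k grows, and the expressions obtained for
   different k agree where they converge. *)
Require Import Defs.
From Stdlib Require Import Reals Lra Lia.
From Coquelicot Require Import Coquelicot.
Open Scope R_scope.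

(** Holomorphy is not deduced from a theorem on limits of holomorphic functions. Each function of
    [s] carries a quadratic remainder bound |F(z,s+h) - F(z,s) - h G(z)| <= M |h|^2 z^e for |h| <=
    1; such bounds can be integrated and summed, and one of them at [s] already gives a complex
    derivative there. [symbol] joins this bound to the growth z^(m - 2 Re s). The class is stable
    under sums and under factors affine in [s], which is what a z-derivative of (cz)^u (cz+a)^(p-s)
    (cz+b)^(q-s) calls for: it gives three functions of the same kind, each with one exponent
    lowered by 1. A single function on all of C needs a number of integrations by parts that varies
    with [s], and this number jumps; near a given point it is traded for a fixed one that suffices
    on a whole disc. The conditions c + a > 0 and c + b > 0 keep the bases cz + a and cz + b
    positive for z >= 1; when c < 1 they do not follow from a, b > -1. C is a real normed module for
    everything in [z] (series, integrals, derivatives) and a complex one for derivatives in [s]. *)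

Notation CR := C_R_NormedModule.
Notation CRc := C_R_CompleteNormedModule.

(** * Calculus of complex-valued functions of a real variable *)

Ltac Cring := match goal with |- @eq _ ?x ?y => change (@eq C x y); ring end.

Lemma norm_CR (z : C) : @norm R_AbsRing CR z = Cmod z.
Proof.
  unfold Cmod, norm; simpl; unfold prod_norm, norm; simpl; unfold abs; simpl.
  f_equal. rewrite !Rmult_1_r. f_equal.
  - symmetry; apply Rsqr_abs.
  - symmetry; apply Rsqr_abs.
Qed.

Lemma scal_CR (r : R) (z : C) : @scal R_AbsRing CR r z = (RtoC r * z)%C.
Proof.
  destruct z as [x y]; unfold scal; simpl; unfold prod_scal, scal; simpl.
  unfold mult, Cmult; simpl. f_equal; ring.
Qed.

(** Over the real scalars, multiplication by a complex [k] is not [scal]; the rules for complex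
    multiples come from its being a bounded linear map. *)
Lemma is_linear_Cmult (k : C) : @is_linear R_AbsRing CR CR (fun z : C => (k * z)%C).
Proof.
  split.
  - intros x y. exact (Cmult_plus_distr_l k x y).
  - intros r x. rewrite !scal_CR. Cring.
  - exists (Cmod k + 1). split.
    + generalize (Cmod_ge_0 k); lra.
    + intros x. rewrite !norm_CR, Cmod_mult.
      generalize (Cmod_ge_0 k) (Cmod_ge_0 x); nra.
Qed.

Lemma continuous_Cmult_l (f : R -> C) (k : C) (x : R) :
  @continuous R_UniformSpace CR f x -> @continuous R_UniformSpace CR (fun t => (k * f t)%C) x.
Proof.
  intros H. apply (@continuous_comp R_UniformSpace CR CR f (fun z => (k * z)%C)).
  - exact H.
  - apply (@linear_cont R_AbsRing CR CR), is_linear_Cmult.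
Qed.

Lemma is_derive_Cmult_l (f : R -> C) (k l : C) (x : R) :
  @is_derive R_AbsRing CR f x l -> @is_derive R_AbsRing CR (fun t => (k * f t)%C) x (k * l)%C.
Proof.
  intros H.
  eapply filterdiff_ext_lin.
  - apply (@filterdiff_comp' R_AbsRing R_NormedModule CR CR f (fun z => (k * z)%C)).
    + exact H.
    + apply filterdiff_linear, is_linear_Cmult.
  - intros y. simpl. rewrite !scal_CR. Cring.
Qed.

Lemma is_RInt_Cmult_l (f : R -> C) (k l : C) (a b : R) :
  @is_RInt CR f a b l -> @is_RInt CR (fun t => (k * f t)%C) a b (k * l)%C.
Proof.
  intros H.
  pose proof (@is_RInt_fct_extend_fst R_NormedModule R_NormedModule f a b l H) as H1.
  pose proof (@is_RInt_fct_extend_snd R_NormedModule R_NormedModule f a b l H) as H2.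
  apply (@is_RInt_fct_extend_pair R_NormedModule R_NormedModule); simpl.
  - apply (@is_RInt_minus R_NormedModule); apply (@is_RInt_scal R_NormedModule); assumption.
  - apply (@is_RInt_plus R_NormedModule); apply (@is_RInt_scal R_NormedModule); assumption.
Qed.

Lemma is_derive_pair (f g : R -> R) (x df dg : R) :
  is_derive f x df -> is_derive g x dg ->
  @is_derive R_AbsRing CR (fun t => (f t, g t)) x (df, dg).
Proof.
  intros Hf Hg.
  apply (@filterdiff_comp'_2 R_AbsRing R_NormedModule R_NormedModule R_NormedModule CR
    f g (fun u v => (u, v)) x (fun y => scal y df) (fun y => scal y dg) (fun u v => (u, v)) Hf Hg).
  apply (@filterdiff_linear R_AbsRing (prod_NormedModule R_AbsRing R_NormedModule R_NormedModule) CR).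
  apply (@is_linear_prod R_AbsRing (prod_NormedModule R_AbsRing R_NormedModule R_NormedModule)
           R_NormedModule R_NormedModule).
  - apply is_linear_fst.
  - apply is_linear_snd.
Qed.

Lemma is_derive_Re (f : R -> C) (x : R) (l : C) :
  @is_derive R_AbsRing CR f x l -> is_derive (fun t => Re (f t)) x (Re l).
Proof.
  intros H.
  apply (@filterdiff_comp' R_AbsRing R_NormedModule CR R_NormedModule f fst x _ fst H).
  apply filterdiff_linear, (@is_linear_fst R_AbsRing R_NormedModule R_NormedModule).
Qed.

Lemma is_derive_Im (f : R -> C) (x : R) (l : C) :
  @is_derive R_AbsRing CR f x l -> is_derive (fun t => Im (f t)) x (Im l).
Proof.
  intros H.
  apply (@filterdiff_comp' R_AbsRing R_NormedModule CR R_NormedModule f snd x _ snd H).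
  apply filterdiff_linear, (@is_linear_snd R_AbsRing R_NormedModule R_NormedModule).
Qed.

(** * The complex exponential and its Taylor bounds *)

Lemma Cexp_plus (v w : C) : Cexp (v + w)%C = (Cexp v * Cexp w)%C.
Proof.
  destruct v as [v1 v2], w as [w1 w2]; unfold Cexp, Cplus, Cmult, Re, Im; simpl.
  rewrite exp_plus, cos_plus, sin_plus. f_equal; ring.
Qed.

Lemma Cexp_0 : Cexp 0 = 1%C.
Proof.
  unfold Cexp, RtoC, Re, Im; simpl. rewrite exp_0, cos_0, sin_0. f_equal; ring.
Qed.

Lemma Cmod_Cexp (w : C) : Cmod (Cexp w) = exp (Re w).
Proof.
  unfold Cmod, Cexp; simpl.
  replace (_ + _) with (Rsqr (exp (Re w))).
  - apply sqrt_Rsqr. left; apply exp_pos.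
  - pose proof (sin2_cos2 (Im w)) as H. unfold Rsqr in *.
    transitivity (exp (Re w) * exp (Re w) * (sin (Im w) * sin (Im w) + cos (Im w) * cos (Im w))).
    + rewrite H; ring.
    + ring.
Qed.

Lemma Cexp_neq_0 (w : C) : Cexp w <> 0%C.
Proof.
  intros H. generalize (exp_pos (Re w)). rewrite <- Cmod_Cexp, H, Cmod_0. lra.
Qed.

Lemma Cexp_opp (w : C) : Cexp (- w)%C = (/ Cexp w)%C.
Proof.
  assert (H : (Cexp (- w) * Cexp w)%C = 1%C).
  { rewrite <- Cexp_plus. replace (- w + w)%C with (RtoC 0) by ring. apply Cexp_0. }
  rewrite <- (Cmult_1_l (/ Cexp w)), <- H. field. apply Cexp_neq_0.
Qed.

Lemma is_derive_Cexp (w : R -> C) (x : R) (l : C) :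
  @is_derive R_AbsRing CR w x l ->
  @is_derive R_AbsRing CR (fun t => Cexp (w t)) x (l * Cexp (w x))%C.
Proof.
  intros H.
  pose proof (is_derive_Re _ _ _ H) as H1.
  pose proof (is_derive_Im _ _ _ H) as H2.
  pose proof (is_derive_comp exp _ x _ _ (is_derive_exp _) H1) as He.
  pose proof (is_derive_comp cos _ x _ _ (is_derive_cos _) H2) as Hc.
  pose proof (is_derive_comp sin _ x _ _ (is_derive_sin _) H2) as Hs.
  pose proof (is_derive_mult _ _ x _ _ He Hc Rmult_comm) as Hec.
  pose proof (is_derive_mult _ _ x _ _ He Hs Rmult_comm) as Hes.
  generalize (is_derive_pair _ _ _ _ _ Hec Hes).
  unfold Cexp, Cmult, plus, mult, scal; simpl; unfold mult; simpl.
  intros HH. eapply eq_rect; [exact HH|].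
  unfold Re, Im in *. f_equal; ring.
Qed.

(** Complex values admit no intermediate point as in the mean value theorem, so the increment is
    written as the integral of the derivative. *)
Lemma Cmod_increment (f df : R -> C) (M : R) :
  (forall t, 0 <= t <= 1 -> @is_derive R_AbsRing CR f t (df t)) ->
  (forall t, 0 <= t <= 1 -> @continuous R_UniformSpace CR df t) ->
  (forall t, 0 <= t <= 1 -> Cmod (df t) <= M) ->
  Cmod (f 1 - f 0)%C <= M.
Proof.
  intros Hd Hc Hb.
  assert (Hi : @is_RInt CR df 0 1 (f 1 - f 0)%C).
  { apply (@is_RInt_derive CRc); rewrite Rmin_left, Rmax_right by lra; assumption. }
  rewrite <- norm_CR. replace M with ((1 - 0) * M) by ring.
  apply (@norm_RInt_le_const CR df 0 1); auto.
  - lra.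
  - intros x Hx. rewrite norm_CR. auto.
Qed.

Lemma is_derive_RtoC_mult (w : C) (t : R) :
  @is_derive R_AbsRing CR (fun t => (RtoC t * w)%C) t w.
Proof.
  destruct w as [u v].
  apply (@is_derive_ext R_AbsRing CR (fun t => (t * u, t * v))).
  - intros y. unfold RtoC, Cmult; simpl. f_equal; ring.
  - apply is_derive_pair; auto_derive; auto; ring.
Qed.

Lemma Cmod_Cexp_line (w : C) (t : R) :
  0 <= t <= 1 -> Cmod (Cexp (RtoC t * w)) <= exp (Cmod w).
Proof.
  intros Ht. rewrite Cmod_Cexp.
  assert (H : Re (RtoC t * w)%C <= Cmod w).
  { eapply Rle_trans; [apply Rle_abs|]. eapply Rle_trans; [apply re_le_Cmod|].
    rewrite Cmod_mult, Cmod_R, Rabs_pos_eq by lra.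
    generalize (Cmod_ge_0 w); nra. }
  destruct H as [H|H]; [left; apply exp_increasing; exact H | rewrite H; right; reflexivity].
Qed.

Lemma continuous_of_is_derive (f : R -> C) (x : R) (l : C) :
  @is_derive R_AbsRing CR f x l -> @continuous R_UniformSpace CR f x.
Proof. intros H. apply (@ex_derive_continuous R_AbsRing CR). exists l; exact H. Qed.

Lemma Cmod_Cexp_sub_1 (w : C) : Cmod (Cexp w - 1)%C <= Cmod w * exp (Cmod w).
Proof.
  replace (Cexp w - 1)%C with (Cexp (RtoC 1 * w) - Cexp (RtoC 0 * w))%C
    by (rewrite Cmult_1_l, Cmult_0_l, Cexp_0; reflexivity).
  apply (Cmod_increment (fun t => Cexp (RtoC t * w)) (fun t => (w * Cexp (RtoC t * w))%C)).
  - intros t _. apply is_derive_Cexp, is_derive_RtoC_mult.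
  - intros t _. apply continuous_Cmult_l.
    eapply continuous_of_is_derive, is_derive_Cexp, is_derive_RtoC_mult.
  - intros t Ht. rewrite Cmod_mult.
    apply Rmult_le_compat_l; [apply Cmod_ge_0 | apply Cmod_Cexp_line, Ht].
Qed.

(** Mean value inequality for exp(tw) - tw along the segment from 0 to w: its derivative w (exp(tw)
    - 1) is controlled by [Cmod_Cexp_sub_1], which supplies the second factor |w|. *)
Lemma Cmod_Cexp_taylor (w : C) :
  Cmod (Cexp w - 1 - w)%C <= Cmod w ^ 2 * exp (Cmod w).
Proof.
  replace (Cexp w - 1 - w)%C
    with ((Cexp (RtoC 1 * w) - RtoC 1 * w) - (Cexp (RtoC 0 * w) - RtoC 0 * w))%C
    by (rewrite Cmult_1_l, Cmult_0_l, Cexp_0; ring).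
  apply (Cmod_increment (fun t => Cexp (RtoC t * w) - RtoC t * w)%C
           (fun t => (w * Cexp (RtoC t * w) - w)%C)).
  - intros t _. apply (@is_derive_minus R_AbsRing CR).
    + apply is_derive_Cexp, is_derive_RtoC_mult.
    + apply is_derive_RtoC_mult.
  - intros t _. apply (@continuous_minus R_UniformSpace R_AbsRing CR).
    + apply continuous_Cmult_l.
      eapply continuous_of_is_derive, is_derive_Cexp, is_derive_RtoC_mult.
    + apply continuous_const.
  - intros t Ht.
    replace (w * Cexp (RtoC t * w) - w)%C with (w * (Cexp (RtoC t * w) - 1))%C by ring.
    rewrite Cmod_mult. simpl. rewrite Rmult_1_r, Rmult_assoc.
    apply Rmult_le_compat_l; [apply Cmod_ge_0|].
    eapply Rle_trans; [apply Cmod_Cexp_sub_1|].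
    rewrite Cmod_mult, Cmod_R, Rabs_pos_eq by lra.
    assert (Hw := Cmod_ge_0 w).
    apply Rmult_le_compat; try nra.
    + left; apply exp_pos.
    + destruct (Req_dec (t * Cmod w) (Cmod w)) as [->|Hn]; [right; reflexivity|].
      left; apply exp_increasing; nra.
Qed.

(** * Complex derivatives from quadratic remainders, and symbol classes *)

Lemma is_derive_of_quadratic (f : C -> C) (s l : C) (M : R) :
  (forall h : C, Cmod h <= 1 -> Cmod (f (s + h) - f s - h * l)%C <= M * Cmod h ^ 2) ->
  @is_derive C_AbsRing C_NormedModule f s l.
Proof.
  intros H. split.
  - apply (@is_linear_scal_l C_AbsRing C_NormedModule).
  - intros x Hx eps.
    apply (@is_filter_lim_locally_unique C_AbsRing (AbsRing_NormedModule C_AbsRing)) in Hx. subst x.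
    (* Radius 1 makes the hypothesis applicable; the other bound gives M |h| <= eps, with |M| + 1
       because [M] may be zero or negative. *)
    assert (Hd : 0 < Rmin 1 (eps / (Rabs M + 1))).
    { apply Rmin_pos; [lra|]. apply Rdiv_lt_0_compat; [apply cond_pos|].
      generalize (Rabs_pos M); lra. }
    apply (@locally_le_locally_norm C_AbsRing (AbsRing_NormedModule C_AbsRing)).
    exists (mkposreal _ Hd). intros y Hy.
    unfold ball_norm in Hy; simpl in Hy.
    change (Cmod (y - s)%C < Rmin 1 (eps / (Rabs M + 1))) in Hy.
    change (Cmod (f y - f s - (y - s) * l)%C <= eps * Cmod (y - s)%C).
    specialize (H (y - s)%C).
    assert (Hys : forall u : C, (s + (u - s))%C = u) by (intros u; ring).
    rewrite Hys in H.
    assert (Hy1 : Cmod (y - s)%C < 1) by (eapply Rlt_le_trans; [exact Hy|apply Rmin_l]).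
    assert (Hy2 : Cmod (y - s)%C < eps / (Rabs M + 1))
      by (eapply Rlt_le_trans; [exact Hy|apply Rmin_r]).
    eapply Rle_trans; [apply H; lra|].
    assert (HM := Rle_abs M). assert (HM' := Rabs_pos M).
    assert (H0 := Cmod_ge_0 (y - s)%C).
    apply (Rmult_lt_compat_r (Rabs M + 1)) in Hy2; [|lra].
    unfold Rdiv in Hy2. rewrite Rmult_assoc, Rinv_l, Rmult_1_r in Hy2 by lra.
    simpl. rewrite Rmult_1_r, <- Rmult_assoc.
    apply Rmult_le_compat_r; [lra|]. nra.
Qed.

(* [G] is the derivative of [F z] at s.  The exponent 6 is slack that absorbs
   z^(2|h|) and the powers of ln z produced by differentiating in s. *)
Definition symbol (m : R) (F : R -> C -> C) : Prop :=
  forall s : C,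
    (forall z, 1 <= z -> @continuous R_UniformSpace CR (fun z => F z s) z) /\
    exists (G : R -> C) (M : R),
      0 <= M /\
      forall z, 1 <= z ->
        @continuous R_UniformSpace CR G z /\
        Cmod (F z s) <= M * Rpower z (m - 2 * Re s) /\
        Cmod (G z) <= M * Rpower z (m - 2 * Re s + 6) /\
        forall h : C, Cmod h <= 1 ->
          Cmod (F z (s + h) - F z s - h * G z)%C
            <= M * Cmod h ^ 2 * Rpower z (m - 2 * Re s + 6).

Lemma Rpower_pos (x y : R) : 0 < Rpower x y.
Proof. apply exp_pos. Qed.

Lemma symbol_le (m m' : R) (F : R -> C -> C) : m <= m' -> symbol m F -> symbol m' F.
Proof.
  intros Hm HF s. destruct (HF s) as [Hc [G [M [HM H]]]].
  split; [exact Hc|]. exists G, M. split; [exact HM|]. intros z Hz.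
  destruct (H z Hz) as [H0 [H1 [H2 H3]]].
  assert (Hp : Rpower z (m - 2 * Re s) <= Rpower z (m' - 2 * Re s))
    by (apply Rle_Rpower; lra).
  assert (Hp' : Rpower z (m - 2 * Re s + 6) <= Rpower z (m' - 2 * Re s + 6))
    by (apply Rle_Rpower; lra).
  repeat split; auto.
  - eapply Rle_trans; [exact H1|]. now apply Rmult_le_compat_l.
  - eapply Rle_trans; [exact H2|]. now apply Rmult_le_compat_l.
  - intros h Hh. eapply Rle_trans; [apply H3, Hh|]. apply Rmult_le_compat_l; auto.
    apply Rmult_le_pos; auto. apply pow2_ge_0.
Qed.

Lemma symbol_plus (m : R) (F1 F2 : R -> C -> C) :
  symbol m F1 -> symbol m F2 -> symbol m (fun z s => (F1 z s + F2 z s)%C).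
Proof.
  intros HF1 HF2 s.
  destruct (HF1 s) as [Hc1 [G1 [M1 [HM1 H1]]]].
  destruct (HF2 s) as [Hc2 [G2 [M2 [HM2 H2]]]].
  split.
  - intros z Hz. apply (@continuous_plus R_UniformSpace R_AbsRing CR); auto.
  - exists (fun z => (G1 z + G2 z)%C), (M1 + M2). split; [lra|]. intros z Hz.
    destruct (H1 z Hz) as [H10 [H11 [H12 H13]]].
    destruct (H2 z Hz) as [H20 [H21 [H22 H23]]].
    split; [|split; [|split]].
    + apply (@continuous_plus R_UniformSpace R_AbsRing CR); auto.
    + eapply Rle_trans; [apply Cmod_triangle|]. lra.
    + eapply Rle_trans; [apply Cmod_triangle|]. lra.
    + intros h Hh.
      replace (F1 z (s + h) + F2 z (s + h) - (F1 z s + F2 z s) - h * (G1 z + G2 z))%C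
        with ((F1 z (s + h) - F1 z s - h * G1 z) + (F2 z (s + h) - F2 z s - h * G2 z))%C
        by ring.
      eapply Rle_trans; [apply Cmod_triangle|].
      specialize (H13 h Hh). specialize (H23 h Hh). lra.
Qed.

(** The factor is free of [z], and the constants in [symbol] may depend on [s], so the order stays
    m. With k the value of the factor at [s], the product rule leaves the remainder (k + be
    h)(F(s+h) - F(s) - h G) + be h^2 G. *)
Lemma symbol_affine (m : R) (F : R -> C -> C) (al be : C) :
  symbol m F -> symbol m (fun z s => ((al + be * s) * F z s)%C).
Proof.
  intros HF s. destruct (HF s) as [Hc [G [M [HM H]]]]. split.
  - intros z Hz. apply continuous_Cmult_l; auto.
  - set (k := (al + be * s)%C).
    (* One |be| comes from |k + be h| <= |k| + |be|, the other from the term be h^2 G. *)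
    exists (fun z => (be * F z s + k * G z)%C), ((Cmod k + 2 * Cmod be) * M).
    assert (Hk := Cmod_ge_0 k). assert (Hb := Cmod_ge_0 be).
    split; [apply Rmult_le_pos; lra|]. intros z Hz.
    destruct (H z Hz) as [H0 [H1 [H2 H3]]].
    assert (Hp : Rpower z (m - 2 * Re s) <= Rpower z (m - 2 * Re s + 6))
      by (apply Rle_Rpower; lra).
    assert (Hp0 := Rpower_pos z (m - 2 * Re s)).
    set (p := Rpower z (m - 2 * Re s)) in *.
    set (p' := Rpower z (m - 2 * Re s + 6)) in *.
    assert (HMp : M * p <= M * p') by (apply Rmult_le_compat_l; lra).
    assert (HMp0 : 0 <= M * p) by (apply Rmult_le_pos; lra).
    split; [|split; [|split]].
    + apply (@continuous_plus R_UniformSpace R_AbsRing CR); apply continuous_Cmult_l; auto.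
    + rewrite Cmod_mult. fold k.
      apply Rle_trans with (Cmod k * (M * p)); [apply Rmult_le_compat_l; auto|]. nra.
    + eapply Rle_trans; [apply Cmod_triangle|]. rewrite !Cmod_mult.
      apply Rle_trans with (Cmod be * (M * p') + Cmod k * (M * p')); [|nra].
      apply Rplus_le_compat; apply Rmult_le_compat_l; auto. lra.
    + intros h Hh. specialize (H3 h Hh).
      replace ((al + be * (s + h)) * F z (s + h) - k * F z s
               - h * (be * F z s + k * G z))%C
        with ((k + be * h) * (F z (s + h) - F z s - h * G z) + be * (h * h) * G z)%C
        by (unfold k; ring).
      eapply Rle_trans; [apply Cmod_triangle|]. rewrite !Cmod_mult.
      assert (Hh0 := Cmod_ge_0 h).
      assert (Hkb : Cmod (k + be * h)%C <= Cmod k + Cmod be).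
      { eapply Rle_trans; [apply Cmod_triangle|]. rewrite Cmod_mult. nra. }
      apply Rle_trans with
        ((Cmod k + Cmod be) * (M * Cmod h ^ 2 * p') + Cmod be * (Cmod h ^ 2) * (M * p')).
      * apply Rplus_le_compat.
        -- apply Rmult_le_compat; auto using Cmod_ge_0.
        -- replace (Cmod h ^ 2) with (Cmod h * Cmod h) by ring.
           apply Rmult_le_compat_l; auto.
           apply Rmult_le_pos; auto. apply Rmult_le_pos; auto.
      * right; ring.
Qed.

(** * The basic functions (cz)^u (cz+a)^(p-s) (cz+b)^(q-s) *)

(** Factor cz + a = (c + a/z) z: for z >= 1 the first factor lies between c and c + a, whose
    logarithms bound its own. *)
Lemma ln_affine_bound (c a : R) :
  0 < c -> 0 < c + a ->
  forall z, 1 <= z -> Rabs (ln (c * z + a) - ln z) <= Rabs (ln c) + Rabs (ln (c + a)).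
Proof.
  intros Hc Hca z Hz.
  assert (Hzz : 0 < / z <= 1).
  { split; [apply Rinv_0_lt_compat; lra|]. rewrite <- Rinv_1. apply Rinv_le_contravar; lra. }
  assert (Hq : c * z + a = (c + a * / z) * z) by (field; lra).
  assert (Hpos : 0 < c + a * / z) by nra.
  rewrite Hq, ln_mult by lra.
  replace (ln (c + a * / z) + ln z - ln z) with (ln (c + a * / z)) by ring.
  assert (Hmono : forall x y, 0 < x -> x <= y -> ln x <= ln y).
  { intros x y Hx [Hxy| ->]; [left; apply ln_increasing; lra | right; reflexivity]. }
  assert (H1 := Rle_abs (ln c)). assert (H2 := Rle_abs (ln (c + a))).
  assert (H3 := Rle_abs (- ln c)). assert (H4 := Rle_abs (- ln (c + a))).
  rewrite Rabs_Ropp in H3, H4.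
  assert (H5 := Rabs_pos (ln c)). assert (H6 := Rabs_pos (ln (c + a))).
  apply Rabs_le.
  destruct (Rle_dec 0 a) as [Ha|Ha].
  - assert (ln c <= ln (c + a * / z)) by (apply Hmono; nra).
    assert (ln (c + a * / z) <= ln (c + a)) by (apply Hmono; nra).
    lra.
  - assert (ln (c + a) <= ln (c + a * / z)) by (apply Hmono; nra).
    assert (ln (c + a * / z) <= ln c) by (apply Hmono; nra).
    lra.
Qed.

Lemma affine_pos (c a z : R) : 0 < c -> 0 < c + a -> 1 <= z -> 0 < c * z + a.
Proof. intros; nra. Qed.

Definition log_sum (a b c z : R) : R := ln (c * z + a) + ln (c * z + b).

Definition log_weight (a b c u p q z : R) : R :=
  u * ln (c * z) + p * ln (c * z + a) + q * ln (c * z + b).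

(* Equals (cz)^u (cz+a)^(p-s) (cz+b)^(q-s) for z >= 1; in one exponential, so
   that the dependence on s is exp(- s log_sum). *)
Definition monomial (a b c u p q z : R) (s : C) : C :=
  Cexp (RtoC (log_weight a b c u p q z) - s * RtoC (log_sum a b c z))%C.

Lemma is_derive_RtoC (f : R -> R) (x l : R) :
  is_derive f x l -> @is_derive R_AbsRing CR (fun t => RtoC (f t)) x (RtoC l).
Proof. intros H. apply is_derive_pair; [exact H|]. apply (@is_derive_const R_AbsRing R_NormedModule). Qed.

Lemma Cexp_RtoC_opp_ln (x : R) : 0 < x -> Cexp (RtoC (- ln x)) = RtoC (/ x).
Proof.
  intros Hx. unfold Cexp, RtoC, Re, Im; simpl.
  rewrite exp_Ropp, exp_ln, cos_0, sin_0 by assumption. f_equal; ring.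
Qed.

(** Lowering one exponent by 1 subtracts the logarithm of its base from [log_weight]; this form
    covers all three bases at once. *)
Lemma monomial_shift (a b c u p q u' p' q' x z : R) (s : C) :
  0 < x ->
  log_weight a b c u' p' q' z = log_weight a b c u p q z - ln x ->
  monomial a b c u' p' q' z s = (RtoC (/ x) * monomial a b c u p q z s)%C.
Proof.
  intros Hx E. unfold monomial. rewrite E, <- Cexp_RtoC_opp_ln, <- Cexp_plus by assumption.
  f_equal. unfold Rminus. rewrite RtoC_plus. ring.
Qed.

(** Every coefficient is written as a constant plus a multiple of [s], even when that multiple is 0,
    to match the factor in [symbol_affine]. *)
Lemma is_derive_monomial (a b c u p q z : R) (s : C) :
  0 < c -> 0 < c + a -> 0 < c + b -> 1 <= z ->
  @is_derive R_AbsRing CR (fun z => monomial a b c u p q z s) z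
    ((RtoC (c * u) + RtoC 0 * s) * monomial a b c (u - 1) p q z s
     + ((RtoC (c * p) + RtoC (- c) * s) * monomial a b c u (p - 1) q z s
     + (RtoC (c * q) + RtoC (- c) * s) * monomial a b c u p (q - 1) z s))%C.
Proof.
  intros Hc Ha Hb Hz.
  assert (H0 : 0 < c * z) by nra.
  assert (HA := affine_pos c a z Hc Ha Hz).
  assert (HB := affine_pos c b z Hc Hb Hz).
  rewrite (monomial_shift a b c u p q (u - 1) p q (c * z)) by (auto; unfold log_weight; ring).
  rewrite (monomial_shift a b c u p q u (p - 1) q (c * z + a)) by (auto; unfold log_weight; ring).
  rewrite (monomial_shift a b c u p q u p (q - 1) (c * z + b)) by (auto; unfold log_weight; ring).
  assert (Hw : is_derive (log_weight a b c u p q) z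
     (u * (c * / (c * z)) + p * (c * / (c * z + a)) + q * (c * / (c * z + b)))).
  { unfold log_weight. auto_derive; [lra | ring]. }
  assert (Hl : is_derive (log_sum a b c) z (c * / (c * z + a) + c * / (c * z + b))).
  { unfold log_sum. auto_derive; [lra | ring]. }
  apply is_derive_RtoC in Hw. apply is_derive_RtoC, (is_derive_Cmult_l _ s) in Hl.
  assert (H := is_derive_Cexp _ _ _ (@is_derive_minus R_AbsRing CR _ _ _ _ _ Hw Hl)).
  eapply eq_rect; [exact H|].
  change minus with Cminus. fold (monomial a b c u p q z s).
  change (Cexp _) with (monomial a b c u p q z s).
  rewrite !RtoC_plus, !RtoC_mult, RtoC_opp. Cring.
Qed.

Lemma exp_le (x y : R) : x <= y -> exp x <= exp y.
Proof. intros [H| ->]; [left; apply exp_increasing, H | right; reflexivity]. Qed.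

Lemma le_exp (x : R) : x <= exp x.
Proof.
  destruct (Req_dec x 0) as [->|Hx]; [left; apply exp_pos|].
  generalize (exp_ineq1 x Hx); lra.
Qed.

Lemma le_exp_3 (x : R) : 0 <= x -> x <= exp (3 * x).
Proof. intros Hx. eapply Rle_trans; [apply le_exp | apply exp_le; lra]. Qed.

(** Each factor x is at most exp x. This trades the powers of the logarithm that arise in
    [s]-derivatives for a power of z. *)
Lemma sqr_mul_exp_le (x : R) : 0 <= x -> x ^ 2 * exp x <= exp (3 * x).
Proof.
  intros Hx. replace (3 * x) with ((x + x) + x) by ring. rewrite !exp_plus.
  apply Rmult_le_compat_r; [left; apply exp_pos|].
  replace (x ^ 2) with (x * x) by ring.
  apply Rmult_le_compat; auto using le_exp.
Qed.

Lemma log_sum_bound (a b c : R) :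
  0 < c -> 0 < c + a -> 0 < c + b ->
  exists rho, 0 <= rho /\ forall z, 1 <= z -> Rabs (log_sum a b c z - 2 * ln z) <= rho.
Proof.
  intros Hc Ha Hb.
  exists ((Rabs (ln c) + Rabs (ln (c + a))) + (Rabs (ln c) + Rabs (ln (c + b)))). split.
  - generalize (Rabs_pos (ln c)) (Rabs_pos (ln (c + a))) (Rabs_pos (ln (c + b))); lra.
  - intros z Hz. unfold log_sum.
    replace (ln (c * z + a) + ln (c * z + b) - 2 * ln z)
      with ((ln (c * z + a) - ln z) + (ln (c * z + b) - ln z)) by ring.
    eapply Rle_trans; [apply Rabs_triang|].
    apply Rplus_le_compat; apply ln_affine_bound; auto.
Qed.

Lemma log_weight_bound (a b c u p q : R) :
  0 < c -> 0 < c + a -> 0 < c + b ->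
  exists rho, forall z, 1 <= z -> log_weight a b c u p q z <= (u + p + q) * ln z + rho.
Proof.
  intros Hc Ha Hb.
  exists (Rabs u * (Rabs (ln c) + Rabs (ln (c + 0))) +
     (Rabs p * (Rabs (ln c) + Rabs (ln (c + a))) +
      Rabs q * (Rabs (ln c) + Rabs (ln (c + b))))).
  intros z Hz.
  assert (H : forall r v, 0 < c + v ->
    r * ln (c * z + v) <= r * ln z + Rabs r * (Rabs (ln c) + Rabs (ln (c + v)))).
  { intros r v Hv.
    assert (r * (ln (c * z + v) - ln z) <= Rabs r * (Rabs (ln c) + Rabs (ln (c + v)))); [|lra].
    eapply Rle_trans; [apply Rle_abs|]. rewrite Rabs_mult.
    apply Rmult_le_compat_l; [apply Rabs_pos|]. apply ln_affine_bound; auto. }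
  unfold log_weight.
  assert (H0 := H u 0). rewrite Rplus_0_r in H0. specialize (H0 ltac:(lra)).
  rewrite Rplus_0_r in H0 |- *.
  specialize (H p a Ha) as H1. specialize (H q b Hb) as H2. lra.
Qed.

Lemma Re_sub_mult_R (x l : R) (s : C) : Re (RtoC x - s * RtoC l)%C = x - Re s * l.
Proof. destruct s; unfold Re; simpl. ring. Qed.

(** With l = [log_sum a b c z], a step h in [s] multiplies the monomial by exp(-h l), so the
    derivative is -l times the monomial. The Taylor remainder is at most |h l|^2 exp |h l| <= |h|^2
    exp(3 |l|), and |l| <= 2 ln z + rho turns this into a power of z. *)
Lemma symbol_monomial (a b c u p q : R) :
  0 < c -> 0 < c + a -> 0 < c + b ->
  symbol (u + p + q) (monomial a b c u p q).
Proof.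
  intros Hc Ha Hb s.
  assert (Hcont : forall z, 1 <= z ->
    @continuous R_UniformSpace CR (fun z => monomial a b c u p q z s) z).
  { intros z Hz. eapply continuous_of_is_derive, is_derive_monomial; auto. }
  split; [exact Hcont|].
  destruct (log_sum_bound a b c Hc Ha Hb) as [rho [Hrho Hls]].
  destruct (log_weight_bound a b c u p q Hc Ha Hb) as [kap Hlw].
  exists (fun z => (RtoC (- log_sum a b c z) * monomial a b c u p q z s)%C),
    (* The first exponential bounds the monomial itself, the second is the constant part of exp(3
       |l|). *)
    (exp (kap + Rabs (Re s) * rho) * exp (3 * rho)).
  assert (He := fun x => exp_pos x).
  split; [left; apply Rmult_lt_0_compat; auto|].
  intros z Hz.
  set (l := log_sum a b c z). set (E := monomial a b c u p q z s).
  assert (Hl : Rabs l <= 2 * ln z + rho).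
  { replace l with ((l - 2 * ln z) + 2 * ln z) by ring.
    eapply Rle_trans; [apply Rabs_triang|].
    assert (0 <= ln z).
    { rewrite <- ln_1. destruct Hz as [Hz| <-]; [left; apply ln_increasing; lra | right; reflexivity]. }
    rewrite (Rabs_pos_eq (2 * ln z)) by lra. specialize (Hls z Hz). fold l in Hls. lra. }
  assert (HE : Cmod E <= exp (kap + Rabs (Re s) * rho) * Rpower z (u + p + q - 2 * Re s)).
  { unfold E, monomial. rewrite Cmod_Cexp, Re_sub_mult_R. unfold Rpower. rewrite <- exp_plus.
    apply exp_le. fold l. specialize (Hlw z Hz).
    assert (- Re s * (l - 2 * ln z) <= Rabs (Re s) * rho).
    { eapply Rle_trans; [apply Rle_abs|]. rewrite Rabs_mult, Rabs_Ropp.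
      apply Rmult_le_compat_l; [apply Rabs_pos | apply Hls, Hz]. }
    lra. }
  assert (HE0 := Cmod_ge_0 E). assert (Hl0 := Rabs_pos l).
  (* The exponent 6 of [symbol] is 3 times the coefficient 2 in |l| <= 2 ln z + rho. *)
  assert (H3l : exp (3 * Rabs l) <= exp (3 * rho) * Rpower z 6).
  { unfold Rpower. rewrite <- exp_plus. apply exp_le. lra. }
  assert (HEl : Cmod E * exp (3 * Rabs l)
     <= exp (kap + Rabs (Re s) * rho) * exp (3 * rho) * Rpower z (u + p + q - 2 * Re s + 6)).
  { rewrite Rpower_plus.
    eapply Rle_trans.
    - apply Rmult_le_compat; [apply HE0 | left; apply He | exact HE | exact H3l].
    - right; ring. }
  split; [|split; [|split]].
  - apply (@continuous_ext R_UniformSpace CR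
      (fun z => @scal R_AbsRing CR (- log_sum a b c z) (monomial a b c u p q z s))).
    + intros y. apply scal_CR.
    + apply (@continuous_scal R_UniformSpace R_AbsRing CR); [|auto].
      apply (@continuous_opp R_UniformSpace R_AbsRing R_NormedModule).
      apply (@ex_derive_continuous R_AbsRing R_NormedModule).
      assert (HA := affine_pos c a z Hc Ha Hz). assert (HB := affine_pos c b z Hc Hb Hz).
      unfold log_sum. auto_derive. lra.
  - eapply Rle_trans; [exact HE|]. apply Rmult_le_compat_r; [left; apply Rpower_pos|].
    rewrite <- (Rmult_1_r (exp (kap + _))) at 1.
    apply Rmult_le_compat_l; [left; apply He|].
    rewrite <- exp_0. apply exp_le. lra.
  - fold l E. rewrite Cmod_mult, Cmod_R, Rabs_Ropp, Rmult_comm.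
    eapply Rle_trans; [|exact HEl]. apply Rmult_le_compat_l; auto. apply le_exp_3; auto.
  - intros h Hh. fold l E.
    replace (monomial a b c u p q z (s + h)) with (E * Cexp (h * RtoC (- l)))%C.
    2: { unfold E, monomial. fold l. rewrite <- Cexp_plus. f_equal. rewrite RtoC_opp. ring. }
    replace (E * Cexp (h * RtoC (- l)) - E - h * (RtoC (- l) * E))%C
      with (E * (Cexp (h * RtoC (- l)) - 1 - h * RtoC (- l)))%C by ring.
    rewrite Cmod_mult.
    apply Rle_trans with (Cmod E * (Cmod h ^ 2 * exp (3 * Rabs l))).
    + apply Rmult_le_compat_l; auto.
      eapply Rle_trans; [apply Cmod_Cexp_taylor|].
      rewrite Cmod_mult, Cmod_R, Rabs_Ropp, Rpow_mult_distr, Rmult_assoc.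
      apply Rmult_le_compat_l; [apply pow2_ge_0|].
      eapply Rle_trans; [|apply sqr_mul_exp_le; auto].
      apply Rmult_le_compat_l; [apply pow2_ge_0|]. apply exp_le.
      assert (Hh0 := Cmod_ge_0 h). nra.
    + replace (Cmod E * (Cmod h ^ 2 * exp (3 * Rabs l)))
        with (Cmod h ^ 2 * (Cmod E * exp (3 * Rabs l))) by ring.
      eapply Rle_trans; [apply Rmult_le_compat_l; [apply pow2_ge_0 | exact HEl]|].
      right; ring.
Qed.

(** * Successive z-derivatives, and the expansion of [phi] *)

(** One derivative is taken first and the other [k] are those of the shifted monomials; this is
    legitimate because the coefficients do not involve [z]. Inductions on [k] must therefore let the
    exponents vary. *)
Fixpoint monomial_deriv (a b c : R) (k : nat) (u p q z : R) (s : C) : C :=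
  match k with
  | O => monomial a b c u p q z s
  | S k =>
      ((RtoC (c * u) + RtoC 0 * s) * monomial_deriv a b c k (u - 1) p q z s
       + ((RtoC (c * p) + RtoC (- c) * s) * monomial_deriv a b c k u (p - 1) q z s
          + (RtoC (c * q) + RtoC (- c) * s) * monomial_deriv a b c k u p (q - 1) z s))%C
  end.

(** A function with all its z-derivatives, each gaining one power of 1/z. This gain moves the
    half-plane of convergence to the left at each integration by parts. *)
Definition symbol_chain (m : R) (F : nat -> R -> C -> C) : Prop :=
  (forall k, symbol (m - INR k) (F k)) /\
  (forall k z s, 1 <= z -> @is_derive R_AbsRing CR (fun z => F k z s) z (F (S k) z s)).

Lemma symbol_chain_monomial (a b c u p q : R) :
  0 < c -> 0 < c + a -> 0 < c + b ->
  symbol_chain (u + p + q) (fun k => monomial_deriv a b c k u p q).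
Proof.
  intros Hc Ha Hb. split.
  - intros k. revert u p q. induction k as [|k IH]; intros u p q.
    + simpl. apply (symbol_le (u + p + q)); [lra|]. apply symbol_monomial; auto.
    + rewrite S_INR. simpl.
      repeat apply symbol_plus; apply symbol_affine.
      * apply (symbol_le (u - 1 + p + q - INR k)); [lra | apply IH].
      * apply (symbol_le (u + (p - 1) + q - INR k)); [lra | apply IH].
      * apply (symbol_le (u + p + (q - 1) - INR k)); [lra | apply IH].
  - intros k. revert u p q. induction k as [|k IH]; intros u p q z s Hz.
    + apply is_derive_monomial; auto.
    + repeat apply (@is_derive_plus R_AbsRing CR);
        (apply is_derive_Cmult_l, IH; exact Hz).
Qed.

Lemma symbol_chain_plus (m : R) (F1 F2 : nat -> R -> C -> C) :
  symbol_chain m F1 -> symbol_chain m F2 ->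
  symbol_chain m (fun k z s => (F1 k z s + F2 k z s)%C).
Proof.
  intros [H1 D1] [H2 D2]. split.
  - intros k. apply symbol_plus; auto.
  - intros k z s Hz. apply (@is_derive_plus R_AbsRing CR); auto.
Qed.

Lemma symbol_chain_scal (m : R) (F : nat -> R -> C -> C) (k : C) :
  symbol_chain m F -> symbol_chain m (fun j z s => ((k + RtoC 0 * s) * F j z s)%C).
Proof.
  intros [H D]. split.
  - intros j. apply symbol_affine; auto.
  - intros j z s Hz. apply is_derive_Cmult_l; auto.
Qed.

Lemma symbol_chain_le (m m' : R) (F : nat -> R -> C -> C) :
  m <= m' -> symbol_chain m F -> symbol_chain m' F.
Proof.
  intros Hm [H D]. split; [|exact D].
  intros k. apply (symbol_le (m - INR k)); [lra | apply H].
Qed.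

Fixpoint polynomial_chain (a b c : R) (p : nat -> C) (d k : nat) (z : R) (s : C) : C :=
  match d with
  | O => ((p O + RtoC 0 * s) * monomial_deriv a b c k 0 0 0 z s)%C
  | S d =>
      (polynomial_chain a b c p d k z s
       + (p (S d) + RtoC 0 * s) * monomial_deriv a b c k (INR (S d)) 0 0 z s)%C
  end.

Lemma symbol_chain_polynomial (a b c : R) (p : nat -> C) (d : nat) :
  0 < c -> 0 < c + a -> 0 < c + b ->
  symbol_chain (INR d) (polynomial_chain a b c p d).
Proof.
  intros Hc Ha Hb. induction d as [|d IH].
  - apply (symbol_chain_le (0 + 0 + 0)); [simpl; lra|].
    apply symbol_chain_scal, symbol_chain_monomial; auto.
  - change (symbol_chain (INR (S d)) (fun k z s => polynomial_chain a b c p d k z s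
       + (p (S d) + RtoC 0 * s) * monomial_deriv a b c k (INR (S d)) 0 0 z s)%C).
    apply symbol_chain_plus.
    + apply (symbol_chain_le (INR d)); [rewrite S_INR; lra | exact IH].
    + apply (symbol_chain_le (INR (S d) + 0 + 0)); [lra|].
      apply symbol_chain_scal, symbol_chain_monomial; auto.
Qed.

Lemma Rcpow_mult_inv (x y : R) (s : C) :
  (/ (Rcpow x s * Rcpow y s))%C = Cexp (- (s * RtoC (ln x + ln y)))%C.
Proof.
  unfold Rcpow. rewrite <- Cexp_plus, <- Cexp_opp, RtoC_plus. f_equal. ring.
Qed.

Lemma monomial_pow (a b c z : R) (n : nat) (s : C) :
  0 < c -> 1 <= z ->
  monomial a b c (INR n) 0 0 z s
  = (RtoC (c * z) ^ n / (Rcpow (c * z + a) s * Rcpow (c * z + b) s))%C.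
Proof.
  intros Hc Hz. unfold Cdiv. rewrite Rcpow_mult_inv. unfold monomial, Cminus.
  rewrite Cexp_plus. f_equal.
  unfold log_weight. rewrite !Rmult_0_l, !Rplus_0_r.
  fold (Rpower (c * z) (INR n)).
  unfold Cexp, Re, Im; simpl. rewrite cos_0, sin_0, Rmult_1_r, Rmult_0_r.
  change (exp _) with (Rpower (c * z) (INR n)).
  rewrite Rpower_pow by nra. rewrite <- RtoC_pow. reflexivity.
Qed.

Lemma phi_eq_polynomial_chain (P : C -> C) (p : nat -> C) (d : nat) (a b c z : R) (s : C) :
  (forall x : C, P x = sum_n (fun k => (p k * x ^ k)%C) d) -> 0 < c -> 1 <= z ->
  phi P z s a b c = polynomial_chain a b c p d 0 z s.
Proof.
  intros HP Hc Hz. unfold phi. rewrite HP. clear HP.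
  set (D := (Rcpow (c * z + a) s * Rcpow (c * z + b) s)%C).
  induction d as [|d IH].
  - rewrite sum_O. cbn [polynomial_chain monomial_deriv].
    change 0 with (INR 0) at 2. rewrite monomial_pow by auto. fold D. unfold Cdiv. ring.
  - rewrite sum_Sn. change (@plus _ ?x ?y) with (Cplus x y).
    cbn [polynomial_chain monomial_deriv]. rewrite <- IH, monomial_pow by auto. fold D.
    unfold Cdiv. ring.
Qed.

(** * Periodised Bernoulli weights on the unit interval *)

(** [bern k] is B_(k+1)(x) / (k+1)!. The recursive integral form gives directly the facts in use:
    continuity, the derivative, and mean zero. *)
Fixpoint bern (k : nat) : R -> R :=
  match k with
  | O => fun x => x - 1 / 2
  | S k => fun x => RInt (bern k) 0 x - RInt (fun y => RInt (bern k) 0 y) 0 1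
  end.

Lemma is_derive_RInt_0 (f : R -> R) (x : R) :
  (forall y, continuous f y) -> is_derive (RInt f 0) x (f x).
Proof.
  intros Hf. apply (@is_derive_RInt R_NormedModule f (RInt f 0) 0).
  - apply filter_forall. intros y. apply (@RInt_correct R_CompleteNormedModule).
    apply (@ex_RInt_continuous R_CompleteNormedModule). auto.
  - apply Hf.
Qed.

Lemma continuous_bern (k : nat) (x : R) : continuous (bern k) x.
Proof.
  revert x. induction k as [|k IH]; intros x; simpl.
  - apply (@ex_derive_continuous R_AbsRing R_NormedModule). auto_derive; auto.
  - apply (@continuous_minus R_UniformSpace R_AbsRing R_NormedModule).
    + apply (@ex_derive_continuous R_AbsRing R_NormedModule).
      eexists. apply is_derive_RInt_0, IH.
    + apply continuous_const.
Qed.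

Lemma is_derive_bern (k : nat) (x : R) : is_derive (bern (S k)) x (bern k x).
Proof.
  rewrite <- (Rminus_0_r (bern k x)). simpl.
  apply (@is_derive_minus R_AbsRing R_NormedModule).
  - apply is_derive_RInt_0, continuous_bern.
  - apply (@is_derive_const R_AbsRing R_NormedModule).
Qed.

Lemma bern_mean_0 (k : nat) : RInt (bern k) 0 1 = 0.
Proof.
  destruct k as [|k].
  - apply (@is_RInt_unique R_CompleteNormedModule).
    replace 0 with (minus ((fun x => x ^ 2 / 2 - x / 2) 1) ((fun x => x ^ 2 / 2 - x / 2) 0)) at 2
      by (unfold minus, plus, opp; simpl; field).
    apply (@is_RInt_derive R_CompleteNormedModule (fun x => x ^ 2 / 2 - x / 2)).
    + intros x _. simpl. auto_derive; auto; field.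
    + intros x _. apply (continuous_bern 0).
  - set (A := RInt (fun y => RInt (bern k) 0 y) 0 1).
    change (RInt (fun x => minus (RInt (bern k) 0 x) A) 0 1 = 0).
    rewrite (@RInt_minus R_CompleteNormedModule).
    + rewrite (@RInt_const R_CompleteNormedModule). fold A.
      unfold minus, plus, opp, scal; simpl; unfold mult; simpl.
      change (A + - ((1 - 0) * A) = 0). ring.
    + apply (@ex_RInt_continuous R_CompleteNormedModule). intros x _.
      apply (@ex_derive_continuous R_AbsRing R_NormedModule).
      eexists. apply is_derive_RInt_0, continuous_bern.
    + apply (@ex_RInt_const R_NormedModule).
Qed.

(** The two end values differ by the mean of [bern k], which is zero. Thanks to this, boundary terms
    telescope from one unit interval to the next. [bern 0] instead goes from -1/2 to 1/2, and this
    jump produces the term phi(1)/2. *)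
Lemma bern_periodic (k : nat) : bern (S k) 1 = bern (S k) 0.
Proof. simpl. rewrite bern_mean_0, (@RInt_point R_CompleteNormedModule). reflexivity. Qed.

Lemma continuous_bounded_unit (f : R -> R) :
  (forall x, continuous f x) ->
  exists B, 0 <= B /\ forall x, 0 <= x <= 1 -> Rabs (f x) <= B.
Proof.
  intros Hf.
  destruct (continuity_ab_maj (fun x => Rabs (f x)) 0 1) as [x0 [H0 _]].
  - lra.
  - intros x _. apply continuity_pt_filterlim.
    apply (@continuous_comp R_UniformSpace R_UniformSpace R_UniformSpace f Rabs).
    + apply Hf.
    + apply (@filterlim_norm R_AbsRing R_NormedModule).
  - exists (Rabs (f x0)). split; [apply Rabs_pos | exact H0].
Qed.

(** * Series of powers and complex series *)

(** Mean value theorem for t^(e+1) on [x, x+1], where t^e is smallest at the right end. It replaces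
    the integral test by a telescoping comparison. *)
Lemma Rpower_sub_ge (e x : R) :
  e < -1 -> 0 < x ->
  (- e - 1) * Rpower (x + 1) e <= Rpower x (e + 1) - Rpower (x + 1) (e + 1).
Proof.
  intros He Hx.
  destruct (MVT_gen (fun t => Rpower t (e + 1)) x (x + 1) (fun t => (e + 1) * Rpower t e))
    as [t [Ht E]].
  - intros t Ht. rewrite Rmin_left in Ht by lra.
    apply is_derive_Reals. replace e with (e + 1 - 1) at 2 by ring.
    apply derivable_pt_lim_power. lra.
  - intros t Ht. rewrite Rmin_left in Ht by lra.
    apply derivable_continuous_pt.
    eexists. apply derivable_pt_lim_power. lra.
  - rewrite Rmin_left, Rmax_right in Ht by lra.
    assert (Hp : Rpower (x + 1) e <= Rpower t e).
    { replace e with (- - e) by ring. rewrite !(Rpower_Ropp _ (- e)).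
      apply Rinv_le_contravar; [apply Rpower_pos|]. apply Rle_Rpower_l; lra. }
    nra.
Qed.

Lemma is_lim_Rpower_neg (e : R) : e < 0 -> is_lim (fun x => Rpower x e) p_infty 0.
Proof.
  intros He. unfold Rpower.
  apply (is_lim_comp exp (fun x => e * ln x) p_infty 0 m_infty).
  - apply is_lim_exp_m.
  - replace m_infty with (Rbar_mult e p_infty).
    + apply is_lim_scal_l, is_lim_ln_p.
    + apply is_Rbar_mult_unique, is_Rbar_mult_sym, is_Rbar_mult_p_infty_neg. exact He.
  - exists 0. intros; discriminate.
Qed.

Lemma is_lim_seq_Rpower_neg (e : R) : e < 0 -> is_lim_seq (fun n => Rpower (INR (S n)) e) 0.
Proof.
  intros He. apply (is_lim_seq_incr_1 (fun n => Rpower (INR n) e)).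
  apply (is_lim_comp_seq (fun x => Rpower x e) INR p_infty 0).
  - apply is_lim_Rpower_neg, He.
  - exists O. intros; discriminate.
  - apply is_lim_seq_INR.
Qed.

Lemma ex_series_Rpower (e : R) : e < -1 -> ex_series (fun n => Rpower (INR (S n)) e).
Proof.
  (* The comparison bounds the power at x + 1 by a difference that starts at x > 0, so the first
     term is set aside. *)
  intros He. apply (ex_series_incr_1 (fun n => Rpower (INR (S n)) e)).
  set (t := fun n => Rpower (INR (S n)) (e + 1)).
  apply (@ex_series_le R_AbsRing R_CompleteNormedModule _
           (fun n => / (- e - 1) * (t n - t (S n)))).
  - intros n. unfold norm; simpl; unfold abs; simpl.
    rewrite Rabs_pos_eq by (left; apply Rpower_pos).
    assert (Hn : 0 < INR (S n)) by (apply lt_0_INR; lia).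
    assert (H := Rpower_sub_ge e (INR (S n)) He Hn).
    rewrite <- S_INR in H. fold (t n) (t (S n)) in H.
    apply (Rmult_le_reg_l (- e - 1)); [lra|].
    rewrite <- Rmult_assoc, Rinv_r, Rmult_1_l by lra. exact H.
  - apply (@ex_series_scal_l R_AbsRing R_NormedModule).
    exists (t O).
    apply (is_lim_seq_ext (fun n => t O - t (S n)) _ (t O)).
    + intros n. induction n as [|n IH].
      * rewrite sum_O. reflexivity.
      * rewrite sum_Sn, <- IH. unfold plus; simpl. ring.
    + replace (Finite (t O)) with (Finite (t O - 0)) by (f_equal; ring).
      apply is_lim_seq_minus'; [apply is_lim_seq_const|].
      apply (is_lim_seq_incr_1 t). apply is_lim_seq_Rpower_neg. lra.
Qed.

(** Built with [iota] exactly as [dirichlet_z] is, so that the two agree by conversion. *)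
Definition csum (u : nat -> C) : C :=
  @iota CRc (fun l => @is_series R_AbsRing CR u l).

Lemma is_series_C_unique (u : nat -> C) (l l' : C) :
  @is_series R_AbsRing CR u l -> @is_series R_AbsRing CR u l' -> l = l'.
Proof. apply (@filterlim_locally_unique nat R_AbsRing CR eventually _). Qed.

Lemma csum_unique (u : nat -> C) (l : C) : @is_series R_AbsRing CR u l -> csum u = l.
Proof.
  intros H. apply (@iota_unique R_AbsRing CRc); [|exact H].
  intros y Hy. exact (is_series_C_unique u y l Hy H).
Qed.

Lemma csum_correct (u : nat -> C) :
  @ex_series R_AbsRing CR u -> @is_series R_AbsRing CR u (csum u).
Proof. intros [l H]. rewrite (csum_unique u l H). exact H. Qed.

Lemma is_series_Cmult_l (k : C) (u : nat -> C) (l : C) :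
  @is_series R_AbsRing CR u l ->
  @is_series R_AbsRing CR (fun n => (k * u n)%C) (k * l)%C.
Proof.
  intros H.
  apply (filterlim_ext (fun n => (k * @sum_n CR u n)%C)).
  - intros n. induction n as [|n IH].
    + rewrite !sum_O. reflexivity.
    + rewrite !sum_Sn, <- IH. exact (Cmult_plus_distr_l k _ _).
  - eapply filterlim_comp; [exact H|].
    apply (@linear_cont R_AbsRing CR CR), is_linear_Cmult.
Qed.

Lemma Cmod_series_le (u : nat -> C) (v : nat -> R) (l : C) (w : R) :
  @is_series R_AbsRing CR u l -> is_series v w ->
  (forall n, Cmod (u n) <= v n) -> Cmod l <= w.
Proof.
  intros Hu Hv Huv.
  apply (is_lim_seq_le (fun n => @norm R_AbsRing CR (sum_n u n)) (sum_n v) (Cmod l) w).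
  - intros n. eapply Rle_trans; [apply (@norm_sum_n_m R_AbsRing CR)|].
    apply sum_n_m_le. intros k. rewrite norm_CR. auto.
  - rewrite <- norm_CR. eapply filterlim_comp; [exact Hu|].
    apply (@filterlim_norm R_AbsRing CR).
  - exact Hv.
Qed.

Lemma ex_series_C_le (u : nat -> C) (v : nat -> R) :
  (forall n, Cmod (u n) <= v n) -> ex_series v -> @ex_series R_AbsRing CR u.
Proof.
  intros H. apply (@ex_series_le R_AbsRing CRc).
  intros n. rewrite norm_CR. auto.
Qed.

(** * Weighted integrals over unit intervals, and their sums *)

(** Index [n] stands for the interval [n+1, n+2]: series are indexed from 0, while [z] starts at
    1. *)
Definition weighted_integral (w : R -> R) (g : R -> C) (n : nat) : C :=
  @RInt CRc (fun x => (RtoC (w x) * g (INR (S n) + x)%R)%C) 0 1.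

Lemma INR_S_ge_1 (n : nat) : 1 <= INR (S n).
Proof. rewrite S_INR. generalize (pos_INR n). lra. Qed.

Lemma is_RInt_weighted (w : R -> R) (g : R -> C) (n : nat) :
  (forall x, continuous w x) ->
  (forall z, 1 <= z -> @continuous R_UniformSpace CR g z) ->
  @is_RInt CR (fun x => (RtoC (w x) * g (INR (S n) + x)%R)%C) 0 1 (weighted_integral w g n).
Proof.
  intros Hw Hg. apply (@RInt_correct CRc), (@ex_RInt_continuous CRc).
  rewrite Rmin_left, Rmax_right by lra. intros x Hx.
  apply (@continuous_ext R_UniformSpace CR
           (fun x => @scal R_AbsRing CR (w x) (g (INR (S n) + x)))).
  - intros y. apply scal_CR.
  - apply (@continuous_scal R_UniformSpace R_AbsRing CR); [apply Hw|].
    apply (@continuous_comp R_UniformSpace R_UniformSpace CR (fun x => INR (S n) + x) g).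
    + apply (@continuous_plus R_UniformSpace R_AbsRing R_NormedModule);
        [apply continuous_const | apply continuous_id].
    + apply Hg. generalize (INR_S_ge_1 n). lra.
Qed.

Lemma Rpower_neg_le (e x y : R) : e <= 0 -> 0 < x -> x <= y -> Rpower y e <= Rpower x e.
Proof.
  intros He Hx Hxy. replace e with (- - e) by ring. rewrite !(Rpower_Ropp _ (- e)).
  apply Rinv_le_contravar; [apply Rpower_pos|]. apply Rle_Rpower_l; lra.
Qed.

Lemma Cmod_weighted_integral_le (w : R -> R) (g : R -> C) (B M e : R) (n : nat) :
  (forall x, continuous w x) ->
  (forall x, 0 <= x <= 1 -> Rabs (w x) <= B) ->
  (forall z, 1 <= z -> @continuous R_UniformSpace CR g z) ->
  (forall z, 1 <= z -> Cmod (g z) <= M * Rpower z e) ->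
  0 <= M -> e <= 0 ->
  Cmod (weighted_integral w g n) <= B * M * Rpower (INR (S n)) e.
Proof.
  intros Hw HB Hg HM HM0 He.
  rewrite <- norm_CR.
  replace (B * M * Rpower (INR (S n)) e) with ((1 - 0) * (B * (M * Rpower (INR (S n)) e))) by ring.
  refine (@norm_RInt_le_const CR _ 0 1 _ _ _ _ (is_RInt_weighted w g n Hw Hg)); [lra|].
  intros x Hx. assert (Hn := INR_S_ge_1 n).
  rewrite norm_CR, Cmod_mult, Cmod_R.
  apply Rmult_le_compat; auto using Rabs_pos, Cmod_ge_0.
  eapply Rle_trans; [apply HM; lra|].
  apply Rmult_le_compat_l; auto. apply Rpower_neg_le; lra.
Qed.

Lemma ex_series_weighted (w : R -> R) (g : R -> C) (M e : R) :
  (forall x, continuous w x) ->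
  (forall z, 1 <= z -> @continuous R_UniformSpace CR g z) ->
  (forall z, 1 <= z -> Cmod (g z) <= M * Rpower z e) ->
  0 <= M -> e < -1 ->
  @ex_series R_AbsRing CR (weighted_integral w g).
Proof.
  intros Hw Hg HM HM0 He.
  destruct (continuous_bounded_unit w Hw) as [B [HB0 HB]].
  apply (ex_series_C_le _ (fun n => B * M * Rpower (INR (S n)) e)).
  - intros n. apply Cmod_weighted_integral_le; auto; lra.
  - apply (@ex_series_scal_l R_AbsRing R_NormedModule), ex_series_Rpower, He.
Qed.

Lemma ex_series_weighted_symbol (w : R -> R) (m : R) (F : R -> C -> C) (s : C) :
  (forall x, continuous w x) -> symbol m F -> m - 2 * Re s < -1 ->
  @ex_series R_AbsRing CR (weighted_integral w (fun z => F z s)).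
Proof.
  intros Hw HF Hs. destruct (HF s) as [Hc [G [M [HM H]]]].
  apply (ex_series_weighted w _ M (m - 2 * Re s)); auto.
  intros z Hz. apply H, Hz.
Qed.

(** The remainder of the sum is the sum of the weighted integrals of the remainders, each at most B
    M |h|^2 (n+1)^e. The condition on [s] says that these powers are summable with the loss of 6
    included. *)
Lemma ex_derive_weighted_series (w : R -> R) (m : R) (F : R -> C -> C) (s : C) :
  (forall x, continuous w x) -> symbol m F -> m - 2 * Re s + 6 < -1 ->
  @ex_derive C_AbsRing C_NormedModule
    (fun s => csum (weighted_integral w (fun z => F z s))) s.
Proof.
  intros Hw HF Hs. destruct (HF s) as [Hc [G [M [HM H]]]].
  destruct (continuous_bounded_unit w Hw) as [B [HB0 HB]].
  assert (HcG : forall z, 1 <= z -> @continuous R_UniformSpace CR G z)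
    by (intros z Hz; apply H, Hz).
  set (e := m - 2 * Re s + 6) in *.
  assert (HG : @ex_series R_AbsRing CR (weighted_integral w G)).
  { apply (ex_series_weighted w G M e); auto. intros z Hz; apply H, Hz. }
  destruct (ex_series_Rpower e Hs) as [Z HZ].
  exists (csum (weighted_integral w G)).
  apply (is_derive_of_quadratic _ s _ (B * M * Z)). intros h Hh.
  assert (Hre : - 1 <= Re h).
  { generalize (re_le_Cmod h) (Rle_abs (- Re h)). rewrite Rabs_Ropp. lra. }
  (* A step |h| <= 1 changes 2 Re s by at most 2, well within the margin of 6, so the series
     converges at s + h too. *)
  assert (Hsh : m - 2 * Re (s + h)%C < -1).
  { unfold Re in *; simpl. unfold e in Hs. lra. }
  assert (Hs0 : m - 2 * Re s < -1) by (unfold e in Hs; lra).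
  assert (S1 := csum_correct _ (ex_series_weighted_symbol w m F (s + h)%C Hw HF Hsh)).
  assert (S2 := csum_correct _ (ex_series_weighted_symbol w m F s Hw HF Hs0)).
  assert (S3 := is_series_Cmult_l h _ _ (csum_correct _ HG)).
  assert (S4 := @is_series_minus R_AbsRing CR _ _ _ _
                  (@is_series_minus R_AbsRing CR _ _ _ _ S1 S2) S3).
  replace (B * M * Z * Cmod h ^ 2) with ((B * M * Cmod h ^ 2) * Z) by ring.
  eapply Cmod_series_le.
  - exact S4.
  - apply (@is_series_scal_l R_AbsRing R_NormedModule (B * M * Cmod h ^ 2)), HZ.
  - intros n. cbv beta.
    assert (Hc' : forall z, 1 <= z ->
      @continuous R_UniformSpace CR (fun z => F z (s + h) - F z s - h * G z)%C z).
    { intros z Hz. apply (@continuous_minus R_UniformSpace R_AbsRing CR).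
      - apply (@continuous_minus R_UniformSpace R_AbsRing CR); auto. apply HF, Hz.
      - apply continuous_Cmult_l; auto. }
    match goal with |- Cmod ?X <= _ =>
      replace X with (weighted_integral w (fun z => F z (s + h) - F z s - h * G z)%C n) end.
    + apply Rle_trans with (B * (M * Cmod h ^ 2) * Rpower (INR (S n)) e).
      2: { right. unfold scal; simpl; unfold mult; simpl. ring. }
      apply Cmod_weighted_integral_le; [exact Hw | exact HB | exact Hc' | | |].
      * intros z Hz. apply H; auto.
      * apply Rmult_le_pos; auto. apply pow2_ge_0.
      * lra.
    + assert (I1 := is_RInt_weighted w (fun z => F z (s + h)%C) n Hw (fun z Hz => proj1 (HF _) z Hz)).
      assert (I2 := is_RInt_weighted w (fun z => F z s) n Hw Hc).
      assert (I3 := is_RInt_Cmult_l _ h _ _ _ (is_RInt_weighted w G n Hw HcG)).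
      apply (@is_RInt_unique CRc).
      eapply is_RInt_ext.
      2: exact (@is_RInt_minus CR _ _ _ _ _ _ (@is_RInt_minus CR _ _ _ _ _ _ I1 I2) I3).
      intros x _. simpl. change minus with Cminus. Cring.
Qed.

Lemma weighted_by_parts (w dw : R -> R) (g dg : R -> C) (n : nat) :
  (forall x, is_derive w x (dw x)) -> (forall x, continuous dw x) ->
  (forall z, 1 <= z -> @is_derive R_AbsRing CR g z (dg z)) ->
  (forall z, 1 <= z -> @continuous R_UniformSpace CR dg z) ->
  (weighted_integral dw g n + weighted_integral w dg n)%C
  = (RtoC (w 1) * g (INR (S (S n))) - RtoC (w 0) * g (INR (S n)))%C.
Proof.
  intros Hw Hdw Hg Hdg. assert (Hn := INR_S_ge_1 n).
  assert (Hcw : forall x, continuous w x).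
  { intros x. apply (@ex_derive_continuous R_AbsRing R_NormedModule). eexists; apply Hw. }
  assert (Hcg : forall z, 1 <= z -> @continuous R_UniformSpace CR g z).
  { intros z Hz. eapply continuous_of_is_derive, Hg, Hz. }
  assert (I1 := is_RInt_weighted dw g n Hdw Hcg).
  assert (I2 := is_RInt_weighted w dg n Hcw Hdg).
  assert (I3 := @is_RInt_plus CR _ _ _ _ _ _ I1 I2).
  assert (I4 : @is_RInt CR
    (fun t => plus (@scal R_AbsRing CR (dw t) (g (INR (S n) + t)))
                (@scal R_AbsRing CR (w t) (dg (INR (S n) + t)))) 0 1
    (minus (@scal R_AbsRing CR (w 1) (g (INR (S n) + 1)))
       (@scal R_AbsRing CR (w 0) (g (INR (S n) + 0))))).
  { apply (@is_RInt_scal_derive CRc w (fun t => g (INR (S n) + t)) dw (fun t => dg (INR (S n) + t)));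
      rewrite Rmin_left, Rmax_right by lra; intros t Ht; auto.
    - rewrite <- (scal_one (dg (INR (S n) + t) : CR)).
      apply (@is_derive_comp R_AbsRing CR g (fun t => INR (S n) + t)).
      + apply Hg. lra.
      + auto_derive; auto.
    - apply (@continuous_comp R_UniformSpace R_UniformSpace CR (fun x => INR (S n) + x) dg).
      + apply (@continuous_plus R_UniformSpace R_AbsRing R_NormedModule);
          [apply continuous_const | apply continuous_id].
      + apply Hdg. lra. }
  apply (@is_RInt_unique CRc) in I4.
  apply (is_RInt_ext _ (fun t => plus (@scal R_AbsRing CR (dw t) (g (INR (S n) + t)))
                (@scal R_AbsRing CR (w t) (dg (INR (S n) + t))))) in I3.
  2: { intros x _. rewrite !scal_CR. reflexivity. }
  apply (@is_RInt_unique CRc) in I3.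
  rewrite (S_INR (S n)). rewrite <- (Rplus_0_r (INR (S n))) at 2.
  rewrite <- !scal_CR. rewrite I3 in I4. exact I4.
Qed.

Lemma filterlim_0_of_Cmod_le (u : nat -> C) (v : nat -> R) :
  (forall n, Cmod (u n) <= v n) -> is_lim_seq v 0 ->
  filterlim u eventually (@locally CR (RtoC 0)).
Proof.
  intros Huv Hv. apply filterlim_locally. intros eps.
  destruct (Hv (ball 0 eps) (locally_ball 0 eps)) as [N HN].
  exists N. intros n Hn. apply (@norm_compat1 R_AbsRing CR).
  rewrite norm_CR. change (Cmod (u n - 0)%C < eps).
  replace (u n - 0)%C with (u n) by ring.
  eapply Rle_lt_trans; [apply Huv|].
  specialize (HN n Hn). unfold ball in HN; simpl in HN.
  unfold AbsRing_ball, abs, minus, plus, opp in HN; simpl in HN.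
  eapply Rle_lt_trans; [apply Rle_abs|].
  replace (v n) with (v n + - 0) by ring. exact HN.
Qed.

(** * Iterated integration by parts and the entire continuation *)

(** The Euler-Maclaurin remainder after [k] integrations by parts, up to sign. As a [csum] it is
    meaningful only where the series converges, hence the conditions on [s] in the lemmas about
    it. *)
Definition em_series (F : nat -> R -> C -> C) (k : nat) (s : C) : C :=
  csum (weighted_integral (bern k) (fun z => F (S k) z s)).

(** By [bern_periodic] the boundary terms carry the same constant b at both ends, so the partial
    sums collapse to -b F(1) + b F(n+2), where F is the derivative of index k+1; its negative
    exponent makes F(n+2) vanish in the limit. *)
Lemma em_series_succ (m : R) (F : nat -> R -> C -> C) (k : nat) (s : C) :
  symbol_chain m F -> m - INR (S k) - 2 * Re s < -1 ->
  em_series F k s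
  = (- (RtoC (bern (S k) 0) * F (S k) 1 s) - em_series F (S k) s)%C.
Proof.
  intros [HF HD] Hs.
  assert (Hs' : m - INR (S (S k)) - 2 * Re s < -1) by (rewrite (S_INR (S k)); lra).
  assert (S1 := csum_correct _ (ex_series_weighted_symbol (bern k) _ _ s
                  (continuous_bern k) (HF (S k)) Hs)).
  assert (S2 := csum_correct _ (ex_series_weighted_symbol (bern (S k)) _ _ s
                  (continuous_bern (S k)) (HF (S (S k))) Hs')).
  assert (S3 := @is_series_plus R_AbsRing CR _ _ _ _ S1 S2).
  set (b := RtoC (bern (S k) 0)).
  assert (E : (em_series F k s + em_series F (S k) s)%C = (- (b * F (S k) 1 s))%C).
  2: { rewrite <- E. ring. }
  refine (is_series_C_unique _ _ _ S3 _).
  apply (filterlim_ext (fun n => (- (b * F (S k) 1 s) + b * F (S k) (INR (S (S n))) s)%C)).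
  - assert (T : forall n, (weighted_integral (bern k) (fun z => F (S k) z s) n
        + weighted_integral (bern (S k)) (fun z => F (S (S k)) z s) n)%C
        = (b * F (S k) (INR (S (S n))) s - b * F (S k) (INR (S n)) s)%C).
    { intros n. unfold b. rewrite <- bern_periodic at 1.
      apply weighted_by_parts.
      - apply is_derive_bern.
      - apply continuous_bern.
      - intros z Hz. apply HD, Hz.
      - intros z Hz. apply HF, Hz. }
    intros n. induction n as [|n IH].
    + rewrite sum_O. change plus with Cplus. rewrite T. change (INR 1) with 1. Cring.
    + rewrite sum_Sn, <- IH. change plus with Cplus. rewrite T. Cring.
  - destruct (HF (S k) s) as [_ [G [M [HM H]]]].
    assert (L : filterlim (fun n => F (S k) (INR (S (S n))) s) eventually (@locally CR (RtoC 0))).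
    { apply (filterlim_0_of_Cmod_le _ (fun n => M * Rpower (INR (S n)) (m - INR (S k) - 2 * Re s))).
      - intros n. eapply Rle_trans; [apply H, INR_S_ge_1|].
        apply Rmult_le_compat_l; auto. assert (Hn := INR_S_ge_1 n).
        apply Rpower_neg_le; [lra | lra | rewrite (S_INR (S n)); lra].
      - replace (Finite 0) with (Rbar_mult M 0) by (simpl; f_equal; ring).
        apply is_lim_seq_scal_l, is_lim_seq_Rpower_neg. lra. }
    assert (L' := filterlim_comp _ _ _ _ (fun z : C => (b * z)%C) _ _ _ L
              (@linear_cont R_AbsRing CR CR _ (RtoC 0) (is_linear_Cmult b))).
    assert (L2 := filterlim_comp_2 _ _ (fun x y : C => (x + y)%C) (filterlim_const (- (b * F (S k) 1 s))%C) L'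
         (@filterlim_plus R_AbsRing CR (- (b * F (S k) 1 s))%C (b * 0)%C)).
    replace (@plus CR (- (b * F (S k) 1 s))%C (b * 0)%C) with (- (b * F (S k) 1 s))%C in L2.
    2: { change plus with Cplus. Cring. }
    exact L2.
Qed.

(* The result of [j] integrations by parts in [em_series F k]. *)
Fixpoint em_rec (F : nat -> R -> C -> C) (j k : nat) (s : C) : C :=
  match j with
  | O => em_series F k s
  | S j => (- (RtoC (bern (S k) 0) * F (S k) 1 s) - em_rec F j (S k) s)%C
  end.

(** Only the innermost [em_series], of index k + j, is expanded; the condition on [s] is the one
    that [em_series_succ] asks at that index. *)
Lemma em_rec_succ (m : R) (F : nat -> R -> C -> C) (j k : nat) (s : C) :
  symbol_chain m F -> m - INR (S k + j) - 2 * Re s < -1 ->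
  em_rec F (S j) k s = em_rec F j k s.
Proof.
  intros HF. revert k. induction j as [|j IH]; intros k Hs.
  - rewrite Nat.add_0_r in Hs. simpl. symmetry. apply (em_series_succ m); auto.
  - change (em_rec F (S (S j)) k s)
      with (- (RtoC (bern (S k) 0) * F (S k) 1 s) - em_rec F (S j) (S k) s)%C.
    rewrite IH; [reflexivity|]. replace (S (S k) + j)%nat with (S k + S j)%nat by lia. exact Hs.
Qed.

Lemma em_rec_stable (m : R) (F : nat -> R -> C -> C) (i j k : nat) (s : C) :
  symbol_chain m F -> m - INR (S k + j) - 2 * Re s < -1 ->
  em_rec F (i + j) k s = em_rec F j k s.
Proof.
  intros HF Hs. induction i as [|i IH]; [reflexivity|].
  rewrite <- IH. apply (em_rec_succ m); auto.
  assert (INR (S k + j) <= INR (S k + (i + j))) by (apply le_INR; lia). lra.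
Qed.

Lemma em_rec_eq (m : R) (F : nat -> R -> C -> C) (i j k : nat) (s : C) :
  symbol_chain m F ->
  m - INR (S k + i) - 2 * Re s < -1 -> m - INR (S k + j) - 2 * Re s < -1 ->
  em_rec F i k s = em_rec F j k s.
Proof.
  intros HF Hi Hj. rewrite <- (em_rec_stable m F j i), <- (em_rec_stable m F i j) by auto.
  f_equal. lia.
Qed.

Lemma ex_derive_symbol (m : R) (F : R -> C -> C) (z : R) (s : C) :
  symbol m F -> 1 <= z -> @ex_derive C_AbsRing C_NormedModule (F z) s.
Proof.
  intros HF Hz. destruct (HF s) as [_ [G [M [HM H]]]]. exists (G z).
  apply (is_derive_of_quadratic _ s _ (M * Rpower z (m - 2 * Re s + 6))).
  intros h Hh. eapply Rle_trans; [apply H; auto|]. right; ring.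
Qed.

Lemma ex_derive_Cmult_l (f : C -> C) (k s : C) :
  @ex_derive C_AbsRing C_NormedModule f s ->
  @ex_derive C_AbsRing C_NormedModule (fun s => (k * f s)%C) s.
Proof.
  intros [l Hl]. exists (k * l)%C.
  eapply filterdiff_ext_lin.
  - apply (@filterdiff_comp' C_AbsRing (AbsRing_NormedModule C_AbsRing) C_NormedModule C_NormedModule
             f (fun z : C => (k * z)%C)).
    + exact Hl.
    + apply filterdiff_linear, (@is_linear_scal_r C_AbsRing C_NormedModule k), Cmult_comm.
  - intros y. simpl. change (k * (y * l) = y * (k * l))%C. ring.
Qed.

Lemma ex_derive_em_rec (m : R) (F : nat -> R -> C -> C) (j k : nat) (s : C) :
  symbol_chain m F -> m - INR (S k + j) - 2 * Re s + 6 < -1 ->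
  @ex_derive C_AbsRing C_NormedModule (em_rec F j k) s.
Proof.
  intros [HF HD]. revert k. induction j as [|j IH]; intros k Hs.
  - rewrite Nat.add_0_r in Hs.
    apply (ex_derive_weighted_series (bern k) (m - INR (S k)) (F (S k))); auto.
    apply continuous_bern.
  - apply (@ex_derive_minus C_AbsRing C_NormedModule).
    + apply (@ex_derive_opp C_AbsRing C_NormedModule), ex_derive_Cmult_l.
      apply (ex_derive_symbol (m - INR (S k))); auto. lra.
    + apply IH. replace (S (S k) + j)%nat with (S k + S j)%nat by lia. exact Hs.
Qed.

Lemma lt_INR_up (x : R) : x < INR (Z.to_nat (up x)).
Proof.
  destruct (archimed x) as [H _]. eapply Rlt_le_trans; [exact H|].
  rewrite INR_IZR_INZ. apply IZR_le. lia.
Qed.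

(* The number of integrations by parts is chosen so that the remaining series
   converges absolutely at s. *)
Definition em_entire (m : R) (F : nat -> R -> C -> C) (s : C) : C :=
  em_rec F (Z.to_nat (up (m - 2 * Re s))) 0 s.

Lemma em_entire_eq (m : R) (F : nat -> R -> C -> C) (j : nat) (s : C) :
  symbol_chain m F -> m - INR j - 2 * Re s < 0 ->
  em_entire m F s = em_rec F j 0 s.
Proof.
  intros HF Hj. apply (em_rec_eq m); auto; rewrite plus_INR; change (INR 1) with 1.
  - generalize (lt_INR_up (m - 2 * Re s)). lra.
  - lra.
Qed.

(** The index inside [em_entire] jumps as [s] moves, so it is replaced near [s] by a fixed [j], for
    which [em_rec] takes the same values on the whole unit disc. *)
Lemma entire_em_entire (m : R) (F : nat -> R -> C -> C) :
  symbol_chain m F -> entire (em_entire m F).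
Proof.
  (* The margin 6 is what differentiability at [s] requires; it also covers the change of 2 Re by
     less than 2 on the unit disc. *)
  intros HF s. set (j := Z.to_nat (up (m - 2 * Re s + 6))).
  assert (Hj : m - 2 * Re s + 6 < INR j) by apply lt_INR_up.
  apply (@ex_derive_ext_loc C_AbsRing C_NormedModule (em_rec F j 0)).
  - apply (@locally_le_locally_norm C_AbsRing (AbsRing_NormedModule C_AbsRing)).
    exists (mkposreal 1 Rlt_0_1). intros y Hy.
    change (Cmod (y - s)%C < 1) in Hy. symmetry. apply em_entire_eq; auto.
    assert (H1 := re_le_Cmod (y - s)%C). assert (H2 := Rle_abs (- Re (y - s)%C)).
    rewrite Rabs_Ropp in H2. unfold Re in *; simpl in *. lra.
  - apply (ex_derive_em_rec m); auto. rewrite plus_INR. change (INR 1) with 1. lra.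
Qed.

(** * The improper integral and its splitting into unit intervals *)

(** Comparison with the primitive M t^(e+1) / (e+1). Since e + 1 < 0, the contribution of the upper
    end has a favourable sign and is dropped; a bound free of [y] is what the Cauchy criterion at
    infinity uses. *)
Lemma Cmod_RInt_le_Rpower (g : R -> C) (M e x y : R) :
  (forall z, 1 <= z -> @continuous R_UniformSpace CR g z) ->
  (forall z, 1 <= z -> Cmod (g z) <= M * Rpower z e) ->
  0 <= M -> e < -1 -> 1 <= x -> x <= y ->
  Cmod (@RInt CRc g x y) <= M / (- e - 1) * Rpower x (e + 1).
Proof.
  intros Hc Hb HM He Hx Hxy.
  assert (I1 : @is_RInt CR g x y (@RInt CRc g x y)).
  { apply (@RInt_correct CRc), (@ex_RInt_continuous CRc).
    rewrite Rmin_left, Rmax_right by lra. intros z Hz. apply Hc. lra. }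
  set (H := fun t => M / (e + 1) * Rpower t (e + 1)).
  assert (D : forall t, 0 < t -> is_derive H t (M * Rpower t e)).
  { intros t Ht. replace (M * Rpower t e) with (M / (e + 1) * ((e + 1) * Rpower t e)) by (field; lra).
    apply is_derive_scal, is_derive_Reals.
    replace e with (e + 1 - 1) at 2 by ring. apply derivable_pt_lim_power, Ht. }
  assert (I2 : is_RInt (fun t => M * Rpower t e) x y (H y - H x)).
  { apply (@is_RInt_derive R_CompleteNormedModule H); rewrite Rmin_left, Rmax_right by lra.
    - intros t Ht. apply D. lra.
    - intros t Ht. apply (@ex_derive_continuous R_AbsRing R_NormedModule).
      unfold Rpower. auto_derive. lra. }
  rewrite <- norm_CR. eapply Rle_trans.
  - refine (@norm_RInt_le CR g _ x y _ _ Hxy _ I1 I2).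
    intros z Hz. rewrite norm_CR. apply Hb. lra.
  - unfold H. replace (M / (e + 1)) with (- (M / (- e - 1))) by (field; lra).
    assert (0 <= M / (- e - 1)) by (apply Rdiv_le_0_compat; lra).
    generalize (Rpower_pos y (e + 1)). nra.
Qed.

Lemma improper_integral_converges (g : R -> C) (M e : R) :
  (forall z, 1 <= z -> @continuous R_UniformSpace CR g z) ->
  (forall z, 1 <= z -> Cmod (g z) <= M * Rpower z e) ->
  0 <= M -> e < -1 ->
  exists J : C, filterlim (fun x => @RInt CRc g 1 x) (Rbar_locally p_infty) (@locally CR J).
Proof.
  intros Hc Hb HM He.
  apply (@filterlim_locally_cauchy R CRc (Rbar_locally p_infty) _ (fun x => @RInt CRc g 1 x)).
  intros eps.
  set (K := M / (- e - 1)).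
  exists (fun x => 1 <= x /\ K * Rpower x (e + 1) < eps). split.
  - apply filter_and.
    + exists 1. intros x Hx. lra.
    + assert (L : is_lim (fun x => K * Rpower x (e + 1)) p_infty 0).
      { replace (Finite 0) with (Rbar_mult K 0) by (simpl; f_equal; ring).
        apply is_lim_scal_l, is_lim_Rpower_neg. lra. }
      apply is_lim_spec in L. destruct (L eps) as [X HX]. exists X. intros x Hx.
      specialize (HX x Hx). eapply Rle_lt_trans; [apply Rle_abs|].
      rewrite Rminus_0_r in HX. exact HX.
  - assert (W : forall u v, 1 <= u -> K * Rpower u (e + 1) < eps -> u <= v ->
      @ball CR (@RInt CRc g 1 u) eps (@RInt CRc g 1 v)).
    { intros u v Hu1 Hu Huv. apply (@norm_compat1 R_AbsRing CR).
      rewrite <- (@RInt_Chasles CRc g 1 u v).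
      - rewrite norm_CR. replace (minus _ _) with (@RInt CRc g u v).
        + eapply Rle_lt_trans; [apply (Cmod_RInt_le_Rpower g M e); auto|]. exact Hu.
        + change (@RInt CRc g u v = (@RInt CRc g 1 u + @RInt CRc g u v - @RInt CRc g 1 u)%C).
          assert (R0 : forall x y : C, x = (y + x - y)%C) by (intros; ring). apply R0.
      - apply (@ex_RInt_continuous CRc). rewrite Rmin_left, Rmax_right by lra.
        intros z Hz. apply Hc. lra.
      - apply (@ex_RInt_continuous CRc). rewrite Rmin_left, Rmax_right by lra.
        intros z Hz. apply Hc. lra. }
    intros u v [Hu1 Hu] [Hv1 Hv]. destruct (Rle_dec u v) as [Huv|Huv].
    + apply W; auto.
    + apply (@ball_sym CR), W; auto. lra.
Qed.

Lemma is_RInt_gen_of_filterlim (g : R -> C) (J : C) :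
  (forall z, 1 <= z -> @continuous R_UniformSpace CR g z) ->
  filterlim (fun x => @RInt CRc g 1 x) (Rbar_locally p_infty) (@locally CR J) ->
  @is_RInt_gen CR g (at_point 1) (Rbar_locally p_infty) J.
Proof.
  intros Hc HJ. apply filterlimi_locally. intros eps.
  exists (fun x => x = 1) (fun y => 1 < y /\ @ball CR J eps (@RInt CRc g 1 y)).
  - reflexivity.
  - apply filter_and; [exists 1; auto|].
    apply (HJ (@ball CR J eps)), locally_ball.
  - intros x y -> [Hy H]. exists (@RInt CRc g 1 y). split; [|exact H].
    apply (@RInt_correct CRc), (@ex_RInt_continuous CRc).
    simpl. rewrite Rmin_left, Rmax_right by lra. intros z Hz. apply Hc. lra.
Qed.

Lemma weighted_integral_1 (g : R -> C) (n : nat) :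
  (forall z, 1 <= z -> @continuous R_UniformSpace CR g z) ->
  weighted_integral (fun _ => 1) g n = @RInt CRc g (INR (S n)) (INR (S (S n))).
Proof.
  intros Hc. assert (Hn := INR_S_ge_1 n).
  apply (@is_RInt_unique CRc).
  apply (is_RInt_ext (fun x => @scal R_AbsRing CR 1 (g (1 * x + INR (S n))))).
  - intros x _. rewrite scal_CR. f_equal. f_equal. ring.
  - apply (@is_RInt_comp_lin CR). rewrite Rmult_0_r, Rplus_0_l, Rmult_1_r.
    replace (1 + INR (S n)) with (INR (S (S n))) by (rewrite (S_INR (S n)); ring).
    apply (@RInt_correct CRc), (@ex_RInt_continuous CRc).
    rewrite (S_INR (S n)), Rmin_left, Rmax_right by lra. intros z Hz. apply Hc. lra.
Qed.

Lemma is_series_unit_integrals (g : R -> C) (J : C) :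
  (forall z, 1 <= z -> @continuous R_UniformSpace CR g z) ->
  filterlim (fun x => @RInt CRc g 1 x) (Rbar_locally p_infty) (@locally CR J) ->
  @is_series R_AbsRing CR (weighted_integral (fun _ => 1) g) J.
Proof.
  intros Hc HJ.
  apply (filterlim_ext (fun n => @RInt CRc g 1 (INR (S (S n))))).
  - intros n. induction n as [|n IH].
    + rewrite sum_O, weighted_integral_1 by exact Hc. reflexivity.
    + rewrite sum_Sn, <- IH, weighted_integral_1 by exact Hc. symmetry.
      assert (Hn := INR_S_ge_1 n).
      apply (@RInt_Chasles CRc); apply (@ex_RInt_continuous CRc); intros z Hz; apply Hc.
      * rewrite (S_INR (S n)), Rmin_left in Hz by lra. lra.
      * rewrite (S_INR (S (S n))), (S_INR (S n)), Rmin_left in Hz by lra. lra.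
  - apply (filterlim_comp _ _ _ (fun n => INR (S (S n))) _ _ (Rbar_locally p_infty)); [|exact HJ].
    intros P [X HX]. destruct (is_lim_seq_INR P (ex_intro _ X HX)) as [N HN].
    exists N. intros n Hn. apply HN. lia.
Qed.

(** * The summation formula and the conclusion *)

Lemma euler_maclaurin (m : R) (F : nat -> R -> C -> C) :
  symbol_chain m F ->
  forall s : C, (m + 1) / 2 < Re s ->
    exists A J : C,
      @is_series R_AbsRing CR (fun n => F O (INR (S n)) s) A /\
      @is_RInt_gen CR (fun z => F O z s) (at_point 1) (Rbar_locally p_infty) J /\
      A = (RtoC (1 / 2) * F O 1%R s + J + em_entire m F s)%C.
Proof.
  intros HFD s Hs. assert (HFD' := HFD). destruct HFD' as [HF HD].
  destruct (HF O s) as [Hc [G [M [HM H]]]].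
  assert (He : m - INR 0 - 2 * Re s < -1) by (simpl; lra).
  assert (Hb : forall z, 1 <= z -> Cmod (F O z s) <= M * Rpower z (m - INR 0 - 2 * Re s))
    by (intros z Hz; apply H, Hz).
  destruct (improper_integral_converges _ M _ Hc Hb HM He) as [J HJ].
  assert (HA : exists A : C, @is_series R_AbsRing CR (fun n => F O (INR (S n)) s) A).
  { apply (ex_series_C_le _ (fun n => M * Rpower (INR (S n)) (m - INR 0 - 2 * Re s))).
    - intros n. apply Hb, INR_S_ge_1.
    - apply (@ex_series_scal_l R_AbsRing R_NormedModule), ex_series_Rpower, He. }
  destruct HA as [A HA]. exists A, J.
  split; [exact HA|]. split; [apply is_RInt_gen_of_filterlim; auto|].
  (* Half the series plus half of its shift has the trapezoidal terms (F(n+1) + F(n+2))/2, which are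
     the boundary terms of [bern 0] on [n+1, n+2]. *)
  assert (S1 := is_series_Cmult_l (RtoC (1 / 2)) _ _ HA).
  assert (S2 : @is_series R_AbsRing CR (fun n => F O (INR (S (S n))) s) (A - F O 1%R s)%C).
  { apply (@is_series_incr_1 R_AbsRing CR (fun n => F O (INR (S n)) s)).
    change (INR 1) with 1.
    replace (@plus CR (A - F O 1%R s)%C (F O 1%R s)) with A; [exact HA|].
    change (A = (A - F O 1%R s + F O 1%R s)%C). ring. }
  apply (is_series_Cmult_l (RtoC (1 / 2))) in S2.
  assert (S3 := is_series_unit_integrals (fun z : R => F O z s) J Hc HJ).
  assert (S4 := @is_series_minus R_AbsRing CR _ _ _ _
                  (@is_series_plus R_AbsRing CR _ _ _ _ S1 S2) S3).
  assert (E : em_entire m F s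
    = (RtoC (1 / 2) * A + RtoC (1 / 2) * (A - F O 1%R s) - J)%C).
  (* In the half-plane of the statement no further integration by parts is called for, so the entire
     function is [em_series F 0] there. *)
  { rewrite (em_entire_eq m F 0 s) by (auto; simpl; lra).
    apply csum_unique. eapply (@is_series_ext R_AbsRing CR); [|exact S4].
    intros n. cbv beta.
    assert (P := weighted_by_parts (bern 0) (fun _ => 1) (fun z => F O z s) (fun z => F 1%nat z s) n).
    cbv beta in P.
    change plus with Cplus. change opp with Copp.
    transitivity ((RtoC (bern 0 1) * F O (INR (S (S n))) s - RtoC (bern 0 0) * F O (INR (S n)) s)
       - weighted_integral (fun _ => 1) (fun z => F O z s) n)%C.
    - simpl bern. replace (0 - 1 / 2) with (- (1 / 2)) by field.
      replace (1 - 1 / 2) with (1 / 2) by field. rewrite RtoC_opp. Cring.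
    - rewrite <- P.
      + Cring.
      + intros x. simpl. auto_derive; auto.
      + intros x. apply continuous_const.
      + intros z Hz. apply HD, Hz.
      + intros z Hz. apply (proj1 (HF 1%nat s)), Hz. }
  rewrite E.
  assert (Hhalf : RtoC (1 / 2) = (/ 2)%C) by (rewrite RtoC_div; [field | lra]).
  rewrite Hhalf. field.
Qed.

Theorem proposition1 (d : nat) (P : C -> C) (a b c : R)
  (hP : polynomial_of_degree d P)
  (ha : -1 < a) (hb : -1 < b) (hc : 0 < c)
  (hca : 0 < c + a) (hcb : 0 < c + b) :
  exists I : C -> C,
    entire I /\
    forall s : C, (INR d + 1) / 2 < Re s ->
      @ex_series R_AbsRing C_R_NormedModule (dirichlet_terms P s a b c) /\
      @ex_RInt_gen C_R_NormedModule (fun z : R => phi P z s a b c)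
        (at_point 1) (Rbar_locally p_infty) /\
      dirichlet_z P s a b c =
        (RtoC (1 / 2) * phi P 1 s a b c
         + @RInt_gen C_R_CompleteNormedModule (fun z : R => phi P z s a b c)
             (at_point 1) (Rbar_locally p_infty)
         + I s)%C.
Proof.
  destruct hP as [p [_ HP]].
  set (F := polynomial_chain a b c p d).
  assert (HF : symbol_chain (INR d) F) by (apply symbol_chain_polynomial; auto).
  assert (Hphi : forall z s, 1 <= z -> phi P z s a b c = F O z s)
    by (intros z s Hz; apply phi_eq_polynomial_chain; auto).
  exists (em_entire (INR d) F). split; [apply entire_em_entire, HF|].
  intros s Hs. destruct (euler_maclaurin (INR d) F HF s Hs) as [A [J [HA [HJ E]]]].
  assert (HA' : @is_series R_AbsRing CR (dirichlet_terms P s a b c) A).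
  { apply (@is_series_ext R_AbsRing CR (fun n => F O (INR (S n)) s)); [|exact HA].
    intros n. symmetry. apply Hphi, INR_S_ge_1. }
  assert (HJ' : @is_RInt_gen CR (fun z => phi P z s a b c) (at_point 1) (Rbar_locally p_infty) J).
  { apply (@is_RInt_gen_ext CR (at_point 1) (Rbar_locally p_infty) _ _ (fun z => F O z s));
      [|exact HJ].
    (* The integrands are known to agree only for z >= 1, so they are compared only on intervals
       that start at 1 and extend to the right. *)
    exists (fun x => x = 1) (fun y => 1 < y); [reflexivity | exists 1; auto |].
    intros x y -> Hy z Hz. simpl in Hz. rewrite Rmin_left in Hz by lra.
    symmetry. apply Hphi. lra. }
  split; [exists A; exact HA'|]. split; [exists J; exact HJ'|].
  change (dirichlet_z P s a b c) with (csum (dirichlet_terms P s a b c)).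
  rewrite (csum_unique _ _ HA'), (Hphi 1 s) by lra.
  rewrite (@is_RInt_gen_unique CRc (at_point 1) (Rbar_locally p_infty) _ _ _ J HJ').
  exact E.
Qed.
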